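(* Let $n\ge 3$, let $a_{jk}$ ($j,k=1,\dots,n$) be real-valued locally integrable functions on $[t_0,\infty)$, and assume that for each $k=3,\dots,n$ the relation $\frac{a_{1k}(t)}{a_{12}(t)}$ is well defined on $[t_0,\infty)$ and is absolutely continuous on $[t_0,\infty)$. Consider the system $$\phi_j'=\sum_{k=1}^n a_{jk}(t)\phi_k,\quad j=1,\dots,n,\quad t\ge t_0. \quad (S)$$ If $a_{jk}(t)\ge 0$ for $t\ge t_0$ and all $j\neq k$, $j,k=1,\dots,n$, then every solution $(\phi_1(t),\dots,\phi_n(t))$ of (S) with $\phi_k(t_0)>0$, $k=1,\dots,n$, satisfies $$\phi_k(t)\ \ge\ \phi_k(t_0)\exp\left\{\int_{t_0}^{t}a_{kk}(\tau)\,d\tau\right\},\quad t\ge t_0,\quad k=1,\dots,n.$$ Therefore, the system (S) is nonoscillatory; moreover, if (S) is Lyapunov stable then $$\sup_{t\ge t_0}\int_{t_0}^{t}a_{kk}(\tau)\,d\tau<\infty,\quad k=1,\dots,n,$$ and if (S) is asymptotically stable then $$\int_{t_0}^{+\infty}a_{kk}(\tau)\,d\tau=-\infty,\quad k=1,\dots,n.$$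
   Context: Well-defined relations: for locally integrable functions $u,v$ on $[t_0,\infty)$, the relation $\frac{u(t)}{v(t)}$ is called well defined on $[t_0,\infty)$ if $v(t)\neq 0$ almost everywhere on $[t_0,\infty)$ and there exists a locally integrable function $\mu$ on $[t_0,\infty)$ with $u(t)=\mu(t)v(t)$ almost everywhere on $[t_0,\infty)$; in that case $\frac{u(t)}{v(t)}$ denotes $\mu(t)$, $t\ge t_0$. Solutions of the system are real-valued, locally absolutely continuous, and satisfy the equations almost everywhere. The system (S) is called nonoscillatory if it has a solution $(\phi_1(t),\dots,\phi_n(t))$ such that, for some $T\ge t_0$, $\phi_k(t)\neq 0$ for all $t\ge T$ and all $k=1,\dots,n$. The system (S) is called Lyapunov stable if all its solutions are bounded on $[t_0,\infty)$, and asymptotically stable if all its solutions vanish at $\infty$ (i.e. tend to $0$ as $t\to\infty$). The improper integral $\int_{t_0}^{+\infty}a_{kk}(\tau)\,d\tau$ means $\lim_{t\to+\infty}\int_{t_0}^{t}a_{kk}(\tau)\,d\tau$. *)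

(* Defs.v *)
From mathcomp Require Import all_boot all_order all_algebra.
From mathcomp Require Import all_classical all_reals all_analysis.
Import Order.TTheory GRing.Theory Num.Theory numFieldNormedType.Exports.

Set Implicit Arguments.
Unset Strict Implicit.
Unset Printing Implicit Defensive.

Local Open Scope classical_set_scope.
Local Open Scope ring_scope.

(* [completed_lebesgue_measure] is used rather than [lebesgue_measure], whose
   sigma-algebra is only the Borel one: integrable functions are the
   Lebesgue-measurable ones, not just the Borel-measurable ones. *)

Definition locally_integrable_on {R : realType} (D : set R) (f : R -> R) :=
  forall K, K `<=` D -> compact K ->
    (@completed_lebesgue_measure R).-integrable K (EFin \o f).

Definition absolutely_continuous_on {R : realType} (I : set R) (f : R -> R) :=
  forall e : R, 0 < e -> exists2 d : R, 0 < d &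
    forall (m : nat) (x y : 'I_m -> R),
      (forall i, x i <= y i /\ `[x i, y i] `<=` I) ->
      trivIset [set: 'I_m] (fun i => `]x i, y i[%classic) ->
      \sum_(i < m) (y i - x i) < d ->
      \sum_(i < m) `|f (y i) - f (x i)| < e.

Definition locally_absolutely_continuous_on {R : realType}
    (I : set R) (f : R -> R) :=
  forall b c, `[b, c] `<=` I -> absolutely_continuous_on `[b, c] f.

(* The relation u / v is well defined on [t0, oo[ when some mu satisfies this;
   mu, unique up to a null set, is then the meaning of u / v. *)
Definition is_ratio {R : realType} (t0 : R) (u v mu : R -> R) :=
  [/\ {ae @completed_lebesgue_measure R, forall t, t0 <= t -> v t != 0},
      locally_integrable_on `[t0, +oo[ mu &
      {ae @completed_lebesgue_measure R,
        forall t, t0 <= t -> u t = mu t * v t}].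

(* A solution on [t0, oo[ is given as a function on R whose values before t0
   are irrelevant: the only point of [t0, oo[ at which the two-sided derivative
   depends on them is t0, a null set. *)
Definition is_solution {R : realType} (n : nat) (t0 : R)
    (a : 'I_n -> 'I_n -> R -> R) (phi : 'I_n -> R -> R) :=
  forall j, locally_absolutely_continuous_on `[t0, +oo[ (phi j) /\
    {ae @completed_lebesgue_measure R, forall t, t0 <= t ->
      is_derive t 1 (phi j) (\sum_(k < n) a j k t * phi k t)}.

Definition nonoscillatory {R : realType} (n : nat) (t0 : R)
    (a : 'I_n -> 'I_n -> R -> R) :=
  exists2 phi, is_solution t0 a phi &
    exists2 T, t0 <= T & forall t, T <= t -> forall k, phi k t != 0.

Definition lyapunov_stable {R : realType} (n : nat) (t0 : R)
    (a : 'I_n -> 'I_n -> R -> R) :=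
  forall phi, is_solution t0 a phi ->
    forall k, exists M, forall t, t0 <= t -> `|phi k t| <= M.

Definition asymptotically_stable {R : realType} (n : nat) (t0 : R)
    (a : 'I_n -> 'I_n -> R -> R) :=
  forall phi, is_solution t0 a phi -> forall k, phi k t @[t --> +oo] --> 0.

(* Main.v *)
(* Put A_k(t) = int_{t0}^t a_kk and psi_k = phi_k exp(- A_k). Then almost everywhere
   psi_k' = exp(- A_k) sum_{j <> k} a_kj phi_j, which is nonnegative as long as all
   phi_j are; an absolutely continuous function with almost everywhere nonnegative
   derivative is nondecreasing, so psi_k stays above its positive initial value, and
   positivity never breaks down. A solution with initial values 1 exists because
   psi solves a linear Volterra equation with nonnegative kernel
   a_kj exp(A_j - A_k), for which Picard iteration is monotone. The coefficients
   may be replaced by Borel functions equal to them almost everywhere, and Lebesgue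
   differentiation then recovers them from their indefinite integrals. *)
Require Import Defs.
From mathcomp Require Import all_boot all_order all_algebra.
From mathcomp Require Import all_classical all_reals all_analysis.
From mathcomp Require Import measurable_realfun ring lra.
Import Order.TTheory GRing.Theory Num.Theory numFieldNormedType.Exports.

Set Implicit Arguments.
Unset Strict Implicit.
Unset Printing Implicit Defensive.

Local Open Scope classical_set_scope.
Local Open Scope ring_scope.

(** If [P] failed somewhere, consider the infimum of the failures: the first hypothesis gives [P]
    there, and the second keeps all failures at a positive distance to the right of it. The base
    case is the first hypothesis at [s = a], where its premise is vacuous. *)
Lemma real_induction (R : realType) (a : R) (P : R -> Prop) :
  (forall s, a <= s -> (forall t, a <= t -> t < s -> P t) -> P s) ->
  (forall s, a <= s -> P s ->
    exists2 d, 0 < d & forall t, s <= t -> t < s + d -> P t) ->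
  forall t, a <= t -> P t.
Proof.
move=> Pleft Pright b ab; apply: contrapT => nPb.
pose N := [set t | a <= t /\ ~ P t].
have Nb : N b by [].
have lbN : lbound N a by move=> x [].
have infN : has_inf N by split; [exists b | exists a].
have a_inf : a <= inf N by apply: lb_le_inf; [exists b|].
have Pinf : P (inf N).
  apply: Pleft => // t a_t t_lt; apply: contrapT => nPt.
  by have := ge_inf infN.2 (conj a_t nPt : N t); rewrite leNgt t_lt.
have [d d0 Pd] := Pright _ a_inf Pinf.
have [x [ax nPx] xd] := inf_adherent d0 infN.
by apply: (nPx); apply: Pd => //; exact: (ge_inf infN.2 (conj ax nPx : N x)).
Qed.

(** * Absolute continuity *)

Lemma absolutely_continuous_on_single (R : realType) (I : set R) (f : R -> R) e :
  absolutely_continuous_on I f -> 0 < e ->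
  exists2 d, 0 < d & forall x y, x <= y -> `[x, y] `<=` I -> y - x < d ->
    `|f y - f x| < e.
Proof.
move=> acf e0; have [d d0 hd] := acf e e0; exists d => // x y xy xyI yxd.
have := hd 1%N (fun=> x) (fun=> y); rewrite !big_ord1; apply => //.
by move=> i j _ _ _; rewrite (ord1 i) (ord1 j).
Qed.

Lemma absolutely_continuous_on_continuous (R : realType) (b c : R) (f : R -> R) :
  absolutely_continuous_on `[b, c] f -> {within `[b, c], continuous f}.
Proof.
move=> acf; apply/subspace_continuousP => x bcx.
apply/cvgrPdist_lt => e e0.
have [d d0 hd] := absolutely_continuous_on_single acf e0.
rewrite near_withinE; exists d => //= y xyd bcy.
have sub u v : u \in `[b, c] -> v \in `[b, c] -> `[u, v] `<=` `[b, c].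
  rewrite !in_itv/= => /andP[bu _] /andP[_ vc] w/=.
  by rewrite !in_itv/= => /andP[uw wv]; rewrite (le_trans bu uw) (le_trans wv vc).
have [yx|xy] := leP y x.
  by apply: hd => //; [exact: sub | exact: le_lt_trans (ler_norm _) xyd].
rewrite distrC; apply: hd; [exact: ltW| exact: sub|].
by apply: le_lt_trans xyd; rewrite distrC ler_norm.
Qed.

Lemma absolutely_continuous_on_bounded (R : realType) (b c : R) (f : R -> R) :
  absolutely_continuous_on `[b, c] f ->
  exists2 M, 0 < M & forall x, `[b, c]%classic x -> `|f x| <= M.
Proof.
move=> /absolutely_continuous_on_continuous cf.
have /compact_bounded [M [_ hM]] :=
  continuous_compact cf (@segment_compact _ b c).
exists (Num.max (M + 1) 1); first by rewrite lt_max ltr01 orbT.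
move=> x bcx; apply: (hM (Num.max (M + 1) 1)).
  by rewrite lt_max ltrDl ltr01.
by exists x.
Qed.

(** The common device behind closure under sums, products and exponentials: increments of [h]
    controlled by those of [f] and [g] sum up to something small. Taking [f = g] covers the case of
    one function. *)
Lemma absolutely_continuous_on_lip2 (R : realType) (I : set R)
    (f g h : R -> R) (C : R) :
  absolutely_continuous_on I f -> absolutely_continuous_on I g ->
  (forall x y, I x -> I y ->
    `|h y - h x| <= C * (`|f y - f x| + `|g y - g x|)) ->
  absolutely_continuous_on I h.
Proof.
move=> acf acg hC e e0.
have C1 : 0 < `|C| + 1 by rewrite ltr_wpDl.
(* [C] has no assumed sign, so the divisor is [|C| + 1], which is positive. *)
pose e' := e / 2 / (`|C| + 1).
have e'0 : 0 < e' by rewrite !divr_gt0.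
have [df df0 hf] := acf _ e'0; have [dg dg0 hg] := acg _ e'0.
exists (Num.min df dg); first by rewrite lt_min df0.
move=> m x y xyI triv; rewrite lt_min => /andP[sf sg].
have {}hf := hf _ _ _ xyI triv sf; have {}hg := hg _ _ _ xyI triv sg.
apply: (@le_lt_trans _ _ ((`|C| + 1) *
    (\sum_(i < m) `|f (y i) - f (x i)| + \sum_(i < m) `|g (y i) - g (x i)|))).
  rewrite -big_split/= mulr_sumr; apply: ler_sum => i _.
  have [xy sub] := xyI i.
  apply: le_trans (hC _ _ _ _) _; [by apply: sub; rewrite /= in_itv/= lexx xy..|].
  by rewrite ler_wpM2r ?addr_ge0// (le_trans (ler_norm C))// lerDl.
rewrite mulrC -ltr_pdivlMr//.
by have := ltrD hf hg; rewrite /e' -mulrDl -splitr.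
Qed.

Lemma absolutely_continuous_onM (R : realType) (b c : R) (f g : R -> R) :
  absolutely_continuous_on `[b, c] f -> absolutely_continuous_on `[b, c] g ->
  absolutely_continuous_on `[b, c] (fun x => f x * g x).
Proof.
move=> acf acg.
have [M M0 hM] := absolutely_continuous_on_bounded acf.
have [N N0 hN] := absolutely_continuous_on_bounded acg.
apply: (absolutely_continuous_on_lip2 (C := M + N) acf acg) => x y Ix Iy.
have -> : f y * g y - f x * g x = f y * (g y - g x) + g x * (f y - f x) by ring.
apply: le_trans (ler_normD _ _) _; rewrite !normrM mulrDr addrC lerD//.
  by rewrite ler_wpM2r// (le_trans (hN _ Ix))// lerDr ltW.
by rewrite ler_wpM2r// (le_trans (hM _ Iy))// lerDl ltW.
Qed.

(** For v <= u, exp u - exp v = exp u (1 - exp (v - u)), and 1 - exp (v - u) <= u - v because exp x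
    >= 1 + x. *)
Lemma expR_lipschitz (R : realType) (M u v : R) : u <= M -> v <= M ->
  `|expR u - expR v| <= expR M * `|u - v|.
Proof.
wlog uv : u v / v <= u.
  move=> H uM vM; have [vu|uv] := leP v u; first exact: H.
  by rewrite distrC (distrC u); apply: H => //; exact: ltW.
move=> uM vM; rewrite !ger0_norm ?subr_ge0 ?ler_expR//.
apply: (@le_trans _ _ (expR u * (u - v))); last first.
  by rewrite ler_wpM2r ?subr_ge0// ler_expR.
have -> : v = u + (v - u) by ring.
rewrite expRD -[leLHS]/(expR u - expR u * expR (v - u)) -{1}(mulr1 (expR u)) -mulrBr.
rewrite ler_wpM2l ?expR_ge0//.
by have := expR_ge1Dx (v - u); lra.
Qed.

Lemma absolutely_continuous_on_expR (R : realType) (b c : R) (f : R -> R) :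
  absolutely_continuous_on `[b, c] f ->
  absolutely_continuous_on `[b, c] (fun x => expR (f x)).
Proof.
move=> acf; have [M M0 hM] := absolutely_continuous_on_bounded acf.
apply: (absolutely_continuous_on_lip2 (C := expR M) acf acf) => x y Ix Iy.
have fM z : `[b, c]%classic z -> f z <= M by move=> /hM; exact: le_trans (ler_norm _).
apply: le_trans (expR_lipschitz (fM _ Iy) (fM _ Ix)) _.
by rewrite ler_wpM2l ?expR_ge0// lerDl.
Qed.

(** Near [s] the difference quotients exceed [l - e], hence [- e], for increments of either sign;
    the two signs correspond to [s] being the left or the right endpoint. *)
Lemma is_derive_ge0_near (R : realType) (F : R -> R) (s l e : R) :
  is_derive s 1 F l -> 0 <= l -> 0 < e ->
  exists2 d, 0 < d & forall u v, u <= v -> u = s \/ v = s -> v - u < d ->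
    - e * (v - u) <= F v - F u.
Proof.
move=> [dF <-] l0 e0.
have /cvgrPdist_lt /(_ _ e0) : h^-1 *: (F (h *: 1 + s) - F s) @[h --> 0^'] --> 'D_1 F s.
  exact: dF.
move=> [d /= d0 hd]; exists d => // u v; rewrite le_eqVlt => /predU1P[->|uv].
  by rewrite !subrr mulr0.
have near h : h != 0 -> `|h| < d -> - e < (F (h + s) - F s) / h.
  move=> h0 hlt; have := hd h; rewrite /= sub0r normrN => /(_ hlt h0).
  rewrite [h *: 1]mulr1 -[_ *: _]/(h^-1 * _) mulrC => /(le_lt_trans (ler_norm _)).
  by move: l0; set q := _ / h; set D := 'D_1 F s; lra.
case=> us vud; rewrite us in uv vud *.
  have vs : 0 < v - s by rewrite subr_gt0.
  have := near (v - s) (lt0r_neq0 vs); rewrite gtr0_norm// subrK.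
  by move=> /(_ vud)/ltW; rewrite ler_pdivlMr.
have us' : u - s < 0 by rewrite subr_lt0.
have := near (u - s) (ltr0_neq0 us'); rewrite ltr0_norm// opprB subrK.
move=> /(_ vud)/ltW; rewrite ler_ndivlMr// => le1.
by rewrite -lerN2 opprB; apply: le_trans le1 _; lra.
Qed.

(** * Monotonicity from an almost everywhere nonnegative derivative *)

Section absolutely_continuous_nondecreasing.
Context {R : realType}.
Variables (b c : R) (F : R -> R).

(** The invariant carried from [b] to [c]: any drop of [F] is charged either to the slope [e] or to
    the variation of [F] over finitely many intervals in [U]. The intervals are sorted from left to
    right, so appending one at the right end keeps them disjoint. *)
Definition covered_growth (U : set R) (e t : R) :=
  exists m (x y : nat -> R),
  [/\ forall i, (i < m)%N -> [/\ b <= x i, x i <= y i, y i <= t &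
                                `]x i, y i[ `<=` U],
      forall i j, (i < j < m)%N -> y i <= x j &
      - e * (t - b) - \sum_(i < m) `|F (y i) - F (x i)| <= F t - F b].

Lemma covered_growth_refl U e : covered_growth U e b.
Proof.
exists 0%N, (fun=> 0), (fun=> 0); rewrite big_ord0; split=> //.
by rewrite !subrr mulr0 subr0.
Qed.

Lemma covered_growth_derive U e u v : u <= v -> - e * (v - u) <= F v - F u ->
  covered_growth U e u -> covered_growth U e v.
Proof.
move=> uv Fuv [m [x [y [h1 h2 h3]]]]; exists m, x, y; split=> //.
  by move=> i /h1[? ? yu ?]; split=> //; exact: le_trans yu uv.
by move: h3 Fuv; set S := \sum_(_ < _) _; lra.
Qed.

(** The interval from [u] to [v] becomes the last member of the list, and its own variation pays for
    the change of [F] across it. *)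
Lemma covered_growth_open U e u v : 0 <= e -> b <= u -> u <= v ->
  `]u, v[ `<=` U -> covered_growth U e u -> covered_growth U e v.
Proof.
move=> e0 bu uv uvU [m [x [y [h1 h2 h3]]]].
exists m.+1, (fun i => if (i < m)%N then x i else u),
             (fun i => if (i < m)%N then y i else v); split.
- move=> i _; case: ifPn => im; last by [].
  by have [? ? yu ?] := h1 _ im; split=> //; exact: le_trans yu uv.
- move=> i j /andP[ij]; rewrite ltnS => jm; rewrite (leq_trans ij jm).
  case: ifPn => jm'; first by apply: h2; rewrite ij jm'.
  by case: (h1 _ (leq_trans ij jm)).
- rewrite big_ord_recr/= ltnn.
  under eq_bigr do rewrite ltn_ord.
  move: h3; set S := \sum_(_ < _) _ => h3.
  have := ler_norm (F u - F v); rewrite (distrC (F u)).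
  have : 0 <= e * (v - u) by rewrite mulr_ge0// subr_ge0.
  lra.
Qed.

(** The listed intervals are disjoint and lie in [U], so their total length is below [d] and
    absolute continuity bounds the charged variation by [e]. *)
Lemma covered_growth_bound U e d : measurable U ->
  (@lebesgue_measure R U < d%:E)%E ->
  (forall (m : nat) (x y : 'I_m -> R),
      (forall i, x i <= y i /\ `[x i, y i] `<=` `[b, c]) ->
      trivIset [set: 'I_m] (fun i => `]x i, y i[%classic) ->
      \sum_(i < m) (y i - x i) < d ->
      \sum_(i < m) `|F (y i) - F (x i)| < e) ->
  covered_growth U e c -> - e * (c - b) - e <= F c - F b.
Proof.
move=> mU Ud acF [m [x [y [h1 h2 h3]]]].
suff : \sum_(i < m) `|F (y i) - F (x i)| < e.
  by move: h3; set S := \sum_(_ < _) _; lra.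
have triv : trivIset [set: 'I_m] (fun i : 'I_m => `]x i, y i[%classic).
  apply/trivIsetP => /= i j _ _; wlog ij : i j / (i < j)%N.
    by move=> H; rewrite neq_ltn => /orP[] ij; [|rewrite setIC]; apply: H => //;
      rewrite neq_ltn ij.
  move=> _; apply/seteqP; split => // z /=.
  rewrite !in_itv/= => -[/andP[_ zyi] /andP[xjz _]].
  have := h2 i j; rewrite ij ltn_ord => /(_ isT).
  by move: (lt_trans xjz zyi); lra.
apply: acF => //.
  move=> i; have [bx xy yc _] := h1 _ (ltn_ord i); split=> // z/=.
  by rewrite !in_itv/= => /andP[xz zy]; rewrite (le_trans bx xz) (le_trans zy yc).
rewrite -lte_fin; apply: le_lt_trans Ud.
rewrite -sumEFin (eq_bigr (fun i : 'I_m => lebesgue_measure `]x i, y i[%classic)).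
  rewrite -measure_bigsetU_ord//.
  rewrite le_measure ?inE//; first exact: bigsetU_measurable.
  by elim/big_ind: _ => [//|A B AU BU|i _]; [by rewrite subUset | by case: (h1 _ (ltn_ord i))].
move=> i _; have [_ xy _ _] := h1 _ (ltn_ord i).
rewrite lebesgue_measure_itv/= lte_fin; case: ltP => // yx.
by rewrite EFinB (le_anti (introT andP (conj xy yx))) subee.
Qed.

(* Every point has a neighbourhood on which F decreases with slope at most e, or
   which lies in an open set U of small measure; absolute continuity bounds the
   variation of F over disjoint intervals in U. *)
Lemma absolutely_continuous_on_nondecreasing : b <= c ->
  absolutely_continuous_on `[b, c] F ->
  {ae @lebesgue_measure R, forall t, b <= t -> t <= c ->
    exists2 l, 0 <= l & is_derive t 1 F l} ->
  F b <= F c.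
Proof.
move=> bc acF [N [mN N0 subN]].
have {}N0 : @lebesgue_measure R N = 0%E by exact: N0.
apply/ler_addgt0Pr => e' e'0.
(* With this choice the slope loss [e * (c - b)] and the variation loss [e] add up to [e']. *)
pose e := e' / (c - b + 1).
have e0 : 0 < e by rewrite divr_gt0// ltr_wpDl// subr_ge0.
have [d d0 hd] := acF _ e0.
have [U [oU NU UN]] : exists U, [/\ open U, N `<=` U & (lebesgue_measure (U `\` N) < d%:E)%E].
  by apply: lebesgue_regularity_outer => //; rewrite [X in (X < _)%E]N0.
have Ud : (@lebesgue_measure R U < d%:E)%E.
  have mU := open_measurable oU.
  apply: le_lt_trans UN; rewrite -{1}(setDUK NU).
  rewrite -[leRHS]add0e -{1}N0; apply: measureU2 => //; exact: measurableD.
suff cov t : b <= t -> t <= c -> covered_growth U e t.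
  have := covered_growth_bound (open_measurable oU) Ud hd (cov _ bc (lexx c)).
  have -> : e' = e * (c - b) + e.
    by rewrite -{2}(mulr1 e) -mulrDr /e divfK// gt_eqF// ltr_wpDl// subr_ge0.
  lra.
(* Stated for intervals with [s] at either end, so that it serves both halves of the real induction:
   reaching [s] from the left and leaving it to the right. *)
have step s : b <= s -> s <= c -> exists2 d, 0 < d & forall u v, b <= u -> u <= v ->
    u = s \/ v = s -> v - u < d -> covered_growth U e u -> covered_growth U e v.
  move=> bs sc; have [Ns|Ns] := pselect (N s).
    have /nbhs_ballP[r /= r0 rU] : nbhs s U by exact: open_nbhs_nbhs (conj oU (NU _ Ns)).
    exists r => // u v bu uv us vur; apply: covered_growth_open => //; first exact: ltW.
    move=> z/=; rewrite in_itv/= => /andP[uz zv]; apply: rU.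
    by rewrite /ball/= ltr_norml; case: us vur uz zv => ->; lra.
  have [] : exists2 l, 0 <= l & is_derive s 1 F l.
    by apply: contrapT => no; apply: Ns; apply: subN => /= H; apply: no; exact: H.
  move=> l l0 Fl; have [r r0 hr] := is_derive_ge0_near Fl l0 e0.
  by exists r => // u v bu uv us vur; apply: covered_growth_derive => //; exact: hr.
move: t; apply: real_induction => [s bs IH sc|s bs IH].
  move: bs; rewrite le_eqVlt => /predU1P[<-|bs]; first exact: covered_growth_refl.
  have [r r0 hr] := step _ (ltW bs) sc.
  (* The maximum is a point closer to [s] than [r] that does not fall below [b]. *)
  have ult : Num.max b (s - r / 2) < s by rewrite gt_max bs; lra.
  apply: (hr (Num.max b (s - r / 2)) s) => //; first by rewrite le_max lexx.
  - exact: ltW.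
  - by right.
  - have : s - r / 2 <= Num.max b (s - r / 2) by rewrite le_max lexx orbT.
    lra.
  - by apply: IH; rewrite ?le_max ?lexx//; apply: le_trans sc; exact: ltW.
have [sc|cs] := leP s c; last first.
  by exists 1 => // t st _ tc; move: (lt_le_trans cs st); lra.
have [r r0 hr] := step _ bs sc.
exists r => // t st tsr tc; apply: (hr s t) => //; first by left.
  lra.
exact: IH.
Qed.

End absolutely_continuous_nondecreasing.

(** * Borel versions of Lebesgue-measurable functions *)

(** Both measures restrict the same outer measure, to different sigma-algebras. *)
Lemma completed_lebesgue_measureE (R : realType) (A : set R) :
  @completed_lebesgue_measure R A = @lebesgue_measure R A.
Proof. by []. Qed.

Lemma measurable_completed (R : realType) (A : set R) :
  measurable (A : set (measurableTypeR R)) ->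
  (@wlength R idfun)^*%mu.-cara.-measurable A.
Proof. exact: sub_caratheodory. Qed.

Lemma ae_completed_lebesgue (R : realType) (P : R -> Prop) :
  {ae @lebesgue_measure R, forall x, P x} ->
  {ae @completed_lebesgue_measure R, forall x, P x}.
Proof.
move=> [N [mN N0 PN]]; exists N; split => //; exact: measurable_completed.
Qed.

Lemma measurable_completed_decomp (R : realType) (A : set R) :
  (@wlength R idfun)^*%mu.-cara.-measurable A ->
  exists2 X : set R, measurable (X : set (measurableTypeR R)) &
  exists2 N : set R, (@lebesgue_measure R).-negligible N & X `|` N = A.
Proof.
rewrite -completed_caratheodory_measurable g_sigma_completed_algebra_genE.
by move=> [X mX [N nN XN]]; exists X => //; exists N.
Qed.

(** A null set of the completion is a Borel null set together with a subset of another one, so it is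
    contained in a Borel null set. *)
Lemma ae_lebesgue_completed (R : realType) (P : R -> Prop) :
  {ae @completed_lebesgue_measure R, forall x, P x} ->
  {ae @lebesgue_measure R, forall x, P x}.
Proof.
move=> [A [mA A0 PA]].
have [X mX [N [M [mM M0 NM]] XN]] := measurable_completed_decomp mA.
have X0 : @lebesgue_measure R X = 0%E.
  apply/eqP; rewrite eq_le measure_ge0 andbT -A0 -XN.
  rewrite -[leLHS]completed_lebesgue_measureE; apply: le_outer_measure.
  exact: subsetUl.
exists (X `|` M); split; first exact: measurableU.
  apply/eqP; rewrite eq_le measure_ge0 andbT.
  rewrite (le_trans (measureU2 _ mX mM))// -[leRHS]add0e.
  by apply: leeD; [move: X0 => /eqP | move: M0 => /eqP]; rewrite eq_le => /andP[].
by apply: subset_trans PA _; rewrite -XN; apply: setUS.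
Qed.

Local Notation completed_type R := (caratheodory_type ((@wlength R idfun)^*)%mu).

Lemma completed_measurable_fun (R : realType) (f : R -> R) :
  measurable_fun (setT : set (measurableTypeR R)) f ->
  measurable_fun (setT : set (completed_type R)) f.
Proof. by move=> mf _ B mB; apply: measurable_completed; exact: mf. Qed.

Lemma ae_imply d (T : ringOfSetsType d) (R : realFieldType)
    (mu : {measure set T -> \bar R}) (P Q : T -> Prop) :
  {ae mu, forall x, P x} -> (forall x, P x -> Q x) -> {ae mu, forall x, Q x}.
Proof.
move=> aeP PQ; have F := ae_filter_ringOfSetsType mu.
exact: filterS aeP.
Qed.

Lemma ae_imply2 d (T : ringOfSetsType d) (R : realFieldType)
    (mu : {measure set T -> \bar R}) (P Q S : T -> Prop) :
  {ae mu, forall x, P x} -> {ae mu, forall x, Q x} ->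
  (forall x, P x -> Q x -> S x) -> {ae mu, forall x, S x}.
Proof.
move=> aeP aeQ PQ; have F := ae_filter_ringOfSetsType mu.
exact: filterS2 aeP aeQ.
Qed.

Lemma ae_neq (R : realType) (s : R) : {ae @lebesgue_measure R, forall t, t != s}.
Proof.
exists [set s]; split; [exact: measurable_set1 | exact: lebesgue_measure_set1 |].
by move=> t /= /negP; rewrite negbK => /eqP.
Qed.

(** A function is determined by its superlevel sets at rational levels. Each of them agrees with a
    Borel set up to a null set, and countably many null sets may be discarded together. *)
Lemma borel_version (R : realType) (f : R -> R) :
  measurable_fun (setT : set (completed_type R)) f ->
  exists2 g : R -> R, measurable_fun (setT : set R) g &
    {ae @lebesgue_measure R, forall x, g x = f x}.
Proof.
move=> mf; pose q n : R := ratr (odflt 0 (unpickle n) : rat).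
have /choice[X /all_and2[mX aeX]] n : exists X : set R,
    measurable (X : set (measurableTypeR R)) /\
    {ae @lebesgue_measure R, forall x, X x <-> q n < f x}.
  have mqf : (@wlength R idfun)^*%mu.-cara.-measurable (f @^-1` `]q n, +oo[).
    by rewrite -[X in measurable X]setTI; exact: mf.
  have [X mX [N nN XN]] := measurable_completed_decomp mqf; exists X; split => //.
  apply: negligibleS nN => x /= nX; apply: contrapT => Nx; apply: nX.
  have -> : q n < f x <-> (X `|` N) x by rewrite XN /= in_itv/= andbT.
  by split=> [|[]//]; left.
pose h n (x : R) : \bar R := if x \in X n then (q n)%:E else -oo%E.
(* X n is {q n < f} up to a null set, so f is almost everywhere the supremum of
   the q n over the X n to which the point belongs. *)
pose e (x : R) : \bar R := esups (h ^~ x) 0%N.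
(* On the exceptional null set [e] may be infinite; [fine] then returns 0. *)
exists (fine \o e).
  have me : measurable_fun (setT : set R) e.
    apply: measurable_fun_esups => n; apply: measurable_fun_ifT => //.
    apply: (measurable_fun_bool true); rewrite setTI.
    rewrite (_ : _ @^-1` _ = X n); first exact: mX.
    by rewrite predeqE => x /=; split=> [/set_mem|/mem_set].
  exact: (measurableT_comp (fine_measurable measurableT) me).
apply: ae_imply (ae_foralln aeX) _ => x Xx; rewrite /= /e /esups/=.
rewrite (_ : ereal_sup _ = (f x)%:E)//; apply/eqP; rewrite eq_le; apply/andP; split.
  apply: ge_ereal_sup => _ [n _ <-]; rewrite /h; case: ifPn => [|_]; last exact: leNye.
  by rewrite inE => /Xx /ltW; rewrite lee_fin.
apply/lee_addgt0Pr => d d0.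
have [r] : exists r : rat, ratr r \in `]f x - d, f x[ by apply: rat_in_itvoo; lra.
rewrite in_itv/= => /andP[fr rf].
rewrite -leeBlDr//; apply: le_trans (_ : (q (pickle r))%:E <= _)%E.
  by rewrite /q pickleK/= -EFinB lee_fin ltW.
apply: ereal_sup_ubound; exists (pickle r) => //; rewrite /h mem_set//.
by apply/Xx; rewrite /q pickleK.
Qed.

(** Lebesgue measure is the pushforward of its completion under the identity, so this is a change of
    variables. *)
Lemma integrable_completed (R : realType) (D : set R) (g : R -> R) :
  measurable (D : set (measurableTypeR R)) ->
  measurable_fun (setT : set R) g ->
  (@completed_lebesgue_measure R).-integrable D (EFin \o g) ->
  (@lebesgue_measure R).-integrable D (EFin \o g) /\
  \int[lebesgue_measure]_(x in D) g x =
  \int[completed_lebesgue_measure]_(x in D) g x.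
Proof.
move=> mD mg ig.
have mid : measurable_fun (setT : set (completed_type R)) (id : _ -> measurableTypeR R).
  by move=> _ B mB; rewrite setTI; exact: measurable_completed.
have mEg : measurable_fun (setT : set R) (EFin \o g).
  exact/measurable_EFinP.
have push (h : R -> \bar R) :
    (\int[lebesgue_measure]_(x in D) h x =
     \int[pushforward (@completed_lebesgue_measure R) (id : completed_type R -> measurableTypeR R)]_(x in D) h x)%E.
  exact: eq_measure_integral.
split.
  apply/integrableP; split; first exact: measurable_funTS.
  rewrite push ge0_integral_pushforward//.
    by move/integrableP : ig => [].
  by apply/measurable_funTS; exact: measurableT_comp.
rewrite /Rintegral push; congr fine.
exact: (integral_pushforward mid mEg).
Qed.

(* Vanishing before t0 makes such functions locally integrable on the whole line,
   as [FTC1] requires. *)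
Definition borel_integrable_from {R : realType} (t0 : R) (g : R -> R) :=
  [/\ measurable_fun setT g, forall t, t < t0 -> g t = 0 &
      forall y, (@lebesgue_measure R).-integrable `[t0, y] (EFin \o g)].

Lemma measurable_completed_itv (R : realType) (i : interval R) :
  (@wlength R idfun)^*%mu.-cara.-measurable [set` i].
Proof. by apply: measurable_completed; exact: measurable_itv. Qed.

Lemma segment_sub_ray (R : realType) (t0 y : R) : `[t0, y] `<=` `[t0, +oo[.
Proof. by move=> x /=; rewrite !in_itv/= andbT => /andP[]. Qed.

Lemma ray_bigcup (R : realType) (t0 : R) :
  `[t0, +oo[%classic = \bigcup_n `[t0, n%:R]%classic.
Proof.
rewrite predeqE => x; split=> [|[n _]]; last exact: segment_sub_ray.
rewrite /= in_itv/= andbT => t0x; have xn := archi_boundP (normr_ge0 x).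
by exists (Num.bound `|x|) => //=; rewrite in_itv/= t0x (le_trans (ler_norm x)) ?ltW.
Qed.

Lemma locally_integrable_on_borel (R : realType) (t0 : R) (f : R -> R) :
  locally_integrable_on `[t0, +oo[ f ->
  exists g, [/\ borel_integrable_from t0 g,
    (forall t, t0 <= t -> 0 <= f t) -> forall t, 0 <= g t,
    {ae @completed_lebesgue_measure R, forall t, t0 <= t -> f t = g t} &
    forall y, \int[lebesgue_measure]_(x in `[t0, y]) g x =
              \int[completed_lebesgue_measure]_(x in `[t0, y]) f x].
Proof.
move=> fint; pose D : set R := `[t0, +oo[%classic.
have fy y : (@completed_lebesgue_measure R).-integrable `[t0, y] (EFin \o f).
  by apply: fint; [exact: segment_sub_ray | exact: segment_compact].
have mfD : measurable_fun (D : set (completed_type R)) f.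
  rewrite /D ray_bigcup; apply/measurable_fun_bigcup => n.
    exact: measurable_completed_itv.
  by have /measurable_int/measurable_EFinP := fy n%:R.
have mcD : measurable (D : set (completed_type R)) by exact: measurable_completed_itv.
have mf : measurable_fun (setT : set (completed_type R)) (f \_ D).
  exact: (@measurable_restrictT _ _ (completed_type R) _ D f mcD).1 mfD.
have [g0 mg0 ae0] := borel_version mf.
(* When [f] is nonnegative from [t0] on, the absolute value of the Borel version still agrees with
   [f] there almost everywhere, and is nonnegative everywhere. *)
pose g1 := if pselect (forall t, t0 <= t -> 0 <= f t) then fun x => `|g0 x| else g0.
have mg1 : measurable_fun (setT : set R) g1.
  by rewrite /g1; case: pselect => /= _ //; exact: measurableT_comp.
have ae1 : {ae @lebesgue_measure R, forall t, g1 t = (f \_ D) t}.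
  apply: ae_imply ae0 _ => t g0t; rewrite /g1; case: pselect => [f0|//] /=.
  rewrite g0t patchE; case: ifPn => [|_]; last by rewrite normr0.
  by rewrite inE /D/= in_itv/= andbT => /f0 /ger0_norm.
pose g := g1 \_ D.
have mD : measurable D by exact: measurable_itv.
have mg : measurable_fun (setT : set R) g.
  exact: (measurable_restrictT g1 mD).1 (measurable_funTS mg1).
have aeg : {ae @completed_lebesgue_measure R, forall t, t0 <= t -> f t = g t}.
  apply: ae_completed_lebesgue; apply: ae_imply ae1 _ => t g1t t0t.
  have Dt : t \in D by rewrite inE /D/= in_itv/= t0t.
  by rewrite /g patchE Dt g1t patchE Dt.
have mgc := completed_measurable_fun mg.
have aeE y : ae_eq (@completed_lebesgue_measure R) `[t0, y]%classic (EFin \o f) (EFin \o g).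
  apply: ae_imply aeg _ => t fg; rewrite /= in_itv/= => /andP[t0t _].
  by rewrite fg.
have mEg y : measurable_fun (`[t0, y]%classic : set (completed_type R)) (EFin \o g).
  by apply/measurable_EFinP; exact: measurable_funTS.
have igc y : (@completed_lebesgue_measure R).-integrable `[t0, y] (EFin \o g).
  apply/integrableP; split => //; have /integrableP[mEf] := fy y.
  move=> fy_lty; apply: le_lt_trans fy_lty; rewrite le_eqVlt; apply/orP; left; apply/eqP.
  apply: ae_eq_integral.
  - exact: measurable_completed_itv.
  - exact: measurableT_comp.
  - exact: measurableT_comp.
  - by apply: ae_imply (aeE y) _ => t fg /fg /= [->].
have ig y := integrable_completed (measurable_itv `[t0, y]) mg (igc y).
exists g; split=> //.
- split=> //; last by move=> y; case: (ig y).
  by move=> t tt0; rewrite /g patchE memNset// /D/= in_itv/= andbT => /le_lt_trans/(_ tt0); rewrite ltxx.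
- move=> f0 t; rewrite /g patchE; case: ifPn => // _.
  by rewrite /g1; case: pselect => //=.
- move=> y; rewrite (ig y).2 /Rintegral; congr fine; apply/esym/ae_eq_integral => //.
    exact: measurable_completed_itv.
  by have /integrableP[] := fy y.
Qed.

(** * Indefinite integrals *)

Lemma borel_integrable_from_le (R : realType) (t0 : R) (f g : R -> R) :
  borel_integrable_from t0 g -> measurable_fun setT f ->
  (forall t, `|f t| <= `|g t|) -> borel_integrable_from t0 f.
Proof.
move=> [mg g0 ig] mf fg; split=> // [t tt0|y].
  by apply/eqP; rewrite -normr_le0; apply: le_trans (fg t) _; rewrite g0 ?normr0.
apply: le_integrable (ig y) => //; first by apply/measurable_EFinP; exact: measurable_funTS.
by move=> x _ /=; rewrite lee_fin.
Qed.

Lemma borel_integrable_from_sum (R : realType) (t0 : R) (I : finType)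
    (g : I -> R -> R) :
  (forall i, borel_integrable_from t0 (g i)) ->
  borel_integrable_from t0 (fun t => \sum_i g i t).
Proof.
move=> ig; split=> [|t tt0|y].
- by apply: measurable_sum => i; case: (ig i).
- by rewrite big1// => i _; case: (ig i) => _ /(_ _ tt0).
- have -> : EFin \o (fun t => \sum_i g i t) = (fun t => (\sum_i (g i t)%:E)%E).
    by apply/funext => t /=; rewrite sumEFin.
  by apply: integrable_sum => // i _; case: (ig i) => _ _ /(_ y).
Qed.

Lemma borel_integrable_fromM (R : realType) (t0 : R) (g h : R -> R) :
  borel_integrable_from t0 g -> measurable_fun setT h ->
  (forall y, exists M, forall t, t0 <= t -> t <= y -> `|h t| <= M) ->
  borel_integrable_from t0 (fun t => g t * h t).
Proof.
move=> [mg g0 ig] mh bh; split=> [|t tt0|y].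
- exact: measurable_funM.
- by rewrite g0// mul0r.
- have [M hM] := bh y.
  apply: (@integrableMl _ _ _ lebesgue_measure _ _ (EFin \o g) h) => //.
    exact: measurable_funTS.
  exists M; split; first exact: num_real.
  move=> N MN x; rewrite /= in_itv/= => /andP[t0x xy].
  exact: le_trans (hM _ t0x xy) (ltW MN).
Qed.

Definition primitive {R : realType} (t0 : R) (g : R -> R) (y : R) :=
  \int[lebesgue_measure]_(x in `[t0, y]) g x.

Section primitive.
Context {R : realType}.
Variables (t0 : R) (g : R -> R).
Hypothesis ig : borel_integrable_from t0 g.

Lemma primitive_init y : y <= t0 -> primitive t0 g y = 0.
Proof.
rewrite le_eqVlt => /predU1P[->|yt0].
  by rewrite /primitive set_itv1 Rintegral_set1.
by rewrite /primitive set_itv_ge ?Rintegral_set0// bnd_simp -ltNge.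
Qed.

Lemma primitiveB x y : t0 <= x -> x <= y ->
  primitive t0 g y - primitive t0 g x = \int[lebesgue_measure]_(t in `]x, y]) g t.
Proof.
move=> t0x xy; rewrite /primitive Rintegral_itvB//; by case: ig.
Qed.

Lemma primitive_le x y : (forall t, 0 <= g t) -> x <= y ->
  primitive t0 g x <= primitive t0 g y.
Proof.
move=> g0 xy; have [xt0|t0x] := leP x t0.
  by rewrite primitive_init//; apply: Rintegral_ge0.
by rewrite -subr_ge0 primitiveB ?(ltW t0x)//; apply: Rintegral_ge0.
Qed.

Lemma primitive_ge0 y : (forall t, 0 <= g t) -> 0 <= primitive t0 g y.
Proof. by move=> g0; apply: Rintegral_ge0. Qed.

Lemma normr_primitiveB_le x y : t0 <= x -> x <= y ->
  (`|primitive t0 g y - primitive t0 g x|%:E <=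
   \int[lebesgue_measure]_(t in `]x, y[) `|g t|%:E)%E.
Proof.
move=> t0x xy; rewrite primitiveB//.
have igxy : (@lebesgue_measure R).-integrable `]x, y] (EFin \o g).
  case: ig => _ _ /(_ y); apply: integrableS => //.
  by move=> z; rewrite /= !in_itv/= => /andP[xz ->]; rewrite (le_trans t0x) ?ltW.
rewrite EFin_normr_Rintegral//; apply: le_trans (le_abse_integral _ _ _) _ => //.
  by case/integrableP : igxy.
rewrite integral_itv_bndo_bndc//.
apply/measurable_EFinP/measurableT_comp => //; case: ig => mg _ _.
exact: measurable_funTS.
Qed.

(** The increments over disjoint intervals are bounded by the integral of the absolute value of [g]
    over their union, which is small with the measure of the union. Cutting [g] off outside
    [[t0, c]] makes it integrable on the whole line. *)
Lemma primitive_locally_absolutely_continuous :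
  locally_absolutely_continuous_on `[t0, +oo[ (primitive t0 g).
Proof.
move=> b c bcD e e0; case: ig => mg _ /(_ c) igc.
have igr : (@lebesgue_measure R).-integrable setT (EFin \o (g \_ `[t0, c])).
  by rewrite -restrict_EFin; apply/integrable_restrict => //=; rewrite setTI.
have [d [d0 hd]] := integral_normr_continuous igr e0; exists d => // m x y xyI triv sumd.
pose I i := `]x i, y i[%classic.
have mI i : measurable (I i) by exact: measurable_itv.
pose A := \big[setU/set0]_(i < m) I i.
have mA : measurable A by exact: bigsetU_measurable.
have /(hd _ mA) : (@lebesgue_measure R A < d%:E)%E.
  rewrite /A measure_bigsetU_ord//.
  rewrite (eq_bigr (fun i => (y i - x i)%:E)) ?sumEFin ?lte_fin// => i _.
  transitivity (@lebesgue_measure R `]x i, y i[%classic) => //.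
  rewrite lebesgue_measure_itv/= lte_fin; case: ltP => // yx.
  by have [xy _] := xyI i; rewrite (le_anti (introT andP (conj xy yx))) subrr.
apply: le_lt_trans; rewrite -lee_fin /Rintegral fineK; last first.
  apply: integrable_fin_num => //; apply: integrableS (integrable_norm igr) => //.
rewrite ge0_integral_bigsetU//=; last 3 first.
- exact: index_enum_uniq.
- exact: (sub_trivIset (@subsetT _ _) triv).
- apply/measurable_EFinP/measurableT_comp => //; apply: measurable_funTS.
  by apply/measurable_EFinP; case/integrableP : igr.
rewrite -sumEFin; apply: lee_sum => i _; have [xy sub] := xyI i.
have sub' z : z \in `[x i, y i] -> t0 <= z /\ z <= c.
  move=> /sub /= zbc; have /= := bcD z zbc; rewrite in_itv/= andbT => ->.
  by move: zbc; rewrite in_itv/= => /andP[].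
have [t0x _] : t0 <= x i /\ x i <= c by apply: sub'; rewrite in_itv/= lexx xy.
apply: le_trans (normr_primitiveB_le t0x xy) _.
rewrite le_eqVlt; apply/orP; left; apply/eqP; apply: eq_integral => z.
rewrite inE/= => zI; rewrite patchE mem_set//=.
by have [t0z zc] := sub' _ (subset_itv_oo_cc zI); rewrite in_itv/= t0z.
Qed.

Lemma is_derive_primitive :
  {ae @lebesgue_measure R, forall t, t0 <= t -> is_derive t 1 (primitive t0 g) (g t)}.
Proof.
case: (ig) => mg g0 igy.
have locg : locally_integrable setT g.
  split=> //; first exact: openT.
  move=> K _ cK; have [M [_ hM]] := compact_bounded cK.
  have {}hM z : K z -> z <= `|M| + 1.
    move=> Kz; apply: le_trans (ler_norm z) _; apply: (hM (`|M| + 1)) => //.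
    by rewrite (le_lt_trans (ler_norm M))// ltrDl.
  have mK : measurable K by exact: compact_measurable.
  have /integrableP[_] := igy (`|M| + 1); apply: le_lt_trans.
  (* On [K] the integrand is dominated by its restriction to the segment from [t0] to [|M| + 1], as
     [g] vanishes before [t0]. *)
  rewrite integral_mkcond [leRHS]integral_mkcond; apply: ge0_le_integral => //.
  - by move=> x _; apply: erestrict_ge0.
  - apply/(measurable_restrictT _ _).1 => //.
    by apply/measurable_EFinP/measurableT_comp => //; exact: measurable_funTS.
  - apply/(measurable_restrictT _ _).1 => //.
    apply/measurableT_comp => //; apply/measurable_EFinP; exact: measurable_funTS.
  move=> x _; rewrite !patchE; case: ifPn => [|_]; last first.
    by case: (_ \in _); [exact: abse_ge0 | exact: lexx].
  rewrite inE => /hM xM; case: ifPn => //; rewrite notin_setE/= in_itv/= xM andbT.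
  by move=> /negP; rewrite -ltNge => /g0 ->; rewrite normr0.
(* The differentiation theorem speaks of points strictly above [t0]; the point [t0] is discarded as
   a null set. *)
apply: ae_imply2 (ae_neq t0) (@FTC1 R g (BLeft t0) igy locg) _ => t tt0 H t0t.
have [dF F't] : derivable (primitive t0 g) t 1 /\ (primitive t0 g)^`()%classic t = g t.
  by apply: H; rewrite lte_fin lt_neqAle eq_sym tt0.
by split=> //; rewrite -derive1E.
Qed.

Lemma measurable_primitive : measurable_fun setT (primitive t0 g).
Proof.
have -> : primitive t0 g = primitive t0 g \_ `[t0, +oo[.
  apply/funext => y; rewrite patchE; case: ifPn => //.
  by rewrite notin_setE/= in_itv/= andbT => /negP; rewrite -ltNge => /ltW/primitive_init.
apply/(measurable_restrictT _ _).1; first exact: measurable_itv.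
rewrite ray_bigcup; apply/measurable_fun_bigcup => n; first exact: measurable_itv.
apply: subspace_continuous_measurable_fun; first exact: measurable_itv.
apply: absolutely_continuous_on_continuous.
apply: primitive_locally_absolutely_continuous; exact: segment_sub_ray.
Qed.

End primitive.

(** * Volterra equations with nonnegative kernel *)

Lemma cvg_sumr (R : realType) (I : Type) (s : seq I) (f : I -> nat -> R) (l : I -> R) :
  (forall i, f i m @[m --> \oo] --> l i) ->
  \sum_(i <- s) f i m @[m --> \oo] --> \sum_(i <- s) l i.
Proof.
move=> fl; elim: s => [|i s IH].
  by under eq_fun do rewrite big_nil; rewrite big_nil; exact: cvg_cst.
by under eq_fun do rewrite big_cons; rewrite big_cons; exact: cvgD.
Qed.

Lemma primitive_mono (R : realType) (t0 : R) (f g : R -> R) y :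
  borel_integrable_from t0 f -> borel_integrable_from t0 g ->
  (forall t, f t <= g t) -> primitive t0 f y <= primitive t0 g y.
Proof. by move=> [_ _ fi] [_ _ gi] fg; apply: le_Rintegral. Qed.

Lemma primitive_dominated_cvg (R : realType) (t0 y : R) (f : nat -> R -> R) (g h : R -> R) :
  (forall m, measurable_fun setT (f m)) -> measurable_fun setT g ->
  (forall t, f m t @[m --> \oo] --> g t) ->
  borel_integrable_from t0 h -> (forall m t, `|f m t| <= h t) ->
  primitive t0 (f m) y @[m --> \oo] --> primitive t0 g y.
Proof.
move=> mf mg fg [_ _ hi] fh.
have [] := @dominated_convergence _ _ R lebesgue_measure `[t0, y]%classic
  (measurable_itv _) (fun m => EFin \o f m) (EFin \o g) (EFin \o h).
- by move=> m; apply/measurable_EFinP; apply: measurable_funTS; exact: mf.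
- by apply/measurable_EFinP; apply: measurable_funTS; exact: mg.
- by apply: aeW => x _; apply: cvg_EFin; [exact: nearW | exact: fg].
- exact: hi.
- by apply: aeW => x m _ /=; rewrite lee_fin.
move=> gi _ cvg; apply: fine_cvg.
by rewrite fineK//; exact: integrable_fin_num.
Qed.

Section nonnegative_volterra.
Context {R : realType} {I : finType}.
Variables (t0 : R) (b : I -> I -> R -> R).
Hypothesis ib : forall k j, borel_integrable_from t0 (b k j).
Hypothesis b_ge0 : forall k j t, 0 <= b k j t.

(** One scalar majorant for all components: [B] dominates every row sum of the kernel, and [E]
    solves E' = B E with initial value 1. *)
Let B t := \sum_k \sum_j b k j t.
Let E t := expR (primitive t0 B t).

Let iB : borel_integrable_from t0 B.
Proof. by apply: borel_integrable_from_sum => k; apply: borel_integrable_from_sum. Qed.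

Let B_ge0 t : 0 <= B t.
Proof. by apply: sumr_ge0 => k _; apply: sumr_ge0. Qed.

Let E_ge1 t : 1 <= E t.
Proof. by rewrite -expR0 ler_expR primitive_ge0. Qed.

Let mE : measurable_fun setT E.
Proof. by apply: measurableT_comp => //; exact: measurable_primitive. Qed.

Let E_bounded y : exists M, forall t, t0 <= t -> t <= y -> `|E t| <= M.
Proof.
exists (E y) => t _ ty; rewrite ger0_norm ?expR_ge0// ler_expR.
exact: primitive_le.
Qed.

Let iBE : borel_integrable_from t0 (fun t => B t * E t).
Proof. exact: borel_integrable_fromM. Qed.

(** The difference of [E] and the integral has derivative E B - B E = 0 almost everywhere, so the
    monotonicity criterion bounds it below by its value 1 at [t0]. *)
Let primitive_BE y : 1 + primitive t0 (fun t => B t * E t) y <= E y.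
Proof.
have [yt0|t0y] := leP y t0; first by rewrite primitive_init// addr0.
pose F t := E t - primitive t0 (fun t => B t * E t) t.
have sub := @segment_sub_ray R t0 y.
have acP := primitive_locally_absolutely_continuous iBE sub.
have acE : absolutely_continuous_on `[t0, y] E.
  apply: absolutely_continuous_on_expR.
  exact: primitive_locally_absolutely_continuous.
suff : F t0 <= F y.
  rewrite /F primitive_init// subr0 /E primitive_init// expR0 => F1.
  by rewrite addrC -lerBrDl; move: F1; rewrite lerBrDr -lerBrDl => F1; lra.
apply: absolutely_continuous_on_nondecreasing (ltW t0y) _ _.
  apply: (absolutely_continuous_on_lip2 (C := 1) acE acP) => x z _ _.
  rewrite mul1r /F; have -> : forall p q r s : R, p - q - (r - s) = (p - r) - (q - s).
    by move=> *; ring.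
  exact: ler_normB.
apply: ae_imply2 (is_derive_primitive iB) (is_derive_primitive iBE) _ => t dB dBE t0t _.
exists 0 => //; have ? := dB t0t; have ? := dBE t0t.
have ? : is_derive t 1 E (E t * B t) by exact: is_derive1_comp.
by apply: is_derive_eq; rewrite mulrC subrr.
Qed.

Let integrand (v : I -> R -> R) k t := \sum_j b k j t * v j t.

(** The class preserved by the Picard map. The lower bound makes integrands nonnegative; the upper
    one dominates them by [B t * E t], independently of the iterate. *)
Definition volterra_bounded (v : I -> R -> R) :=
  forall k, measurable_fun setT (v k) /\ forall t, 1 <= v k t <= E t.

Let integrand_bounds v k t : volterra_bounded v ->
  0 <= integrand v k t <= B t * E t.
Proof.
move=> bv; apply/andP; split.
  apply: sumr_ge0 => j _; rewrite mulr_ge0//.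
  by have [_ /(_ t)/andP[/(le_trans ler01)]] := bv j.
(* Only row [k] of the double sum [B] is compared; the other rows contribute nonnegative terms. *)
rewrite /B mulr_suml (bigD1 k)//= mulr_suml ler_wpDr//.
  apply: sumr_ge0 => i _; rewrite mulr_ge0//; last exact: le_trans ler01 _.
  exact: sumr_ge0.
apply: ler_sum => j _; rewrite ler_wpM2l//.
by have [_ /(_ t)/andP[]] := bv j.
Qed.

Let measurable_integrand v k : (forall j, measurable_fun setT (v j)) ->
  measurable_fun setT (integrand v k).
Proof.
move=> mv; apply: measurable_sum => j; apply: measurable_funM => //.
by case: (ib k j).
Qed.

Let iintegrand v k : volterra_bounded v -> borel_integrable_from t0 (integrand v k).
Proof.
move=> bv; apply: borel_integrable_from_le iBE _ _.
  by apply: measurable_integrand => j; case: (bv j).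
move=> t; have /andP[h0 h1] := integrand_bounds k t bv.
by rewrite !ger0_norm// (le_trans h0).
Qed.

Let picard v k t := 1 + primitive t0 (integrand v k) t.

Let picard_bounded v : volterra_bounded v -> volterra_bounded (picard v).
Proof.
move=> bv k; have iv := iintegrand k bv; split.
  by apply: measurable_funD => //; exact: measurable_primitive.
move=> t; rewrite lerDl primitive_ge0; last first.
  by move=> s; have /andP[] := integrand_bounds k s bv.
apply: le_trans (primitive_BE t); rewrite lerD2l; apply: primitive_mono => // s.
by have /andP[] := integrand_bounds k s bv.
Qed.

Let u m := iter m picard (fun _ _ => 1).

Let u_bounded m : volterra_bounded (u m).
Proof.
elim: m => [k|m IH]; last exact: picard_bounded.
by split=> [|t]; [exact: measurable_cst | rewrite /= lexx E_ge1].
Qed.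

(** The start 1 is the lower bound of the class that contains [u 1], and a nonnegative kernel makes
    the Picard map monotone. *)
Let u_nondecreasing k t : nondecreasing_seq (fun m => u m k t).
Proof.
apply/nondecreasing_seqP => m; elim: m k t => [|m IH] k t.
  by have [_ /(_ t)/andP[]] := u_bounded 1 k.
rewrite /= lerD2l; apply: primitive_mono => [||s].
- by apply: iintegrand; exact: (u_bounded m).
- by apply: iintegrand; exact: (u_bounded m.+1).
by apply: ler_sum => j _; rewrite ler_wpM2l//; exact: IH.
Qed.

Let u_is_cvg k t : cvgn (fun m => u m k t).
Proof.
apply: nondecreasing_is_cvgn => //; exists (E t) => _ [m _ <-].
by have [_ /(_ t)/andP[]] := u_bounded m k.
Qed.

(* The Picard iterates started at 1 increase, and stay below exp (int B) for B the
   sum of all the b k j. *)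
Lemma nonnegative_volterra_solution : exists v : I -> R -> R,
  forall k, borel_integrable_from t0 (fun t => \sum_j b k j t * v j t) /\
    forall t, v k t = 1 + primitive t0 (fun t => \sum_j b k j t * v j t) t.
Proof.
pose v k t := limn (fun m => u m k t).
have bv : volterra_bounded v.
  move=> k; split; last first.
    move=> t; apply/andP; split; [apply: limr_ge => // | apply: limr_le => //];
      by near=> m; have [_ /(_ t)/andP[]] := u_bounded m k.
  apply: (measurable_fun_cvg (h := fun m => u m k)) => [m|t _]; last exact: u_is_cvg.
  by case: (u_bounded m k).
exists v => k; split=> [|t]; first exact: iintegrand.
(* The shifted sequence has two limits: [v k t] by definition, and the right-hand side of the
   equation by dominated convergence. Equating them gives the equation. *)
have cvg1 : u m.+1 k t @[m --> \oo] --> v k t.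
  by rewrite (@cvg_shiftS _ (fun m => u m k t)); exact: u_is_cvg.
have cvg2 : u m.+1 k t @[m --> \oo] --> 1 + primitive t0 (integrand v k) t.
  apply: cvgD; first exact: cvg_cst.
  apply: (@primitive_dominated_cvg _ t0 t (fun m => integrand (u m) k)
    (integrand v k) _ _ _ _ iBE).
  - by move=> m; apply: measurable_integrand => j; case: (u_bounded m j).
  - by apply: measurable_integrand => j; case: (bv j).
  - move=> s; apply: cvg_sumr => j; apply: cvgMr; exact: u_is_cvg.
  - move=> m s; have /andP[h0 h1] := integrand_bounds k s (u_bounded m).
    by rewrite ger0_norm.
by rewrite -(cvg_lim _ cvg1)// (cvg_lim _ cvg2).
Unshelve. all: by end_near.
Qed.

End nonnegative_volterra.

Lemma ae_forall_fin d (T : ringOfSetsType d) (R : realFieldType)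
    (mu : {measure set T -> \bar R}) (I : finType) (P : I -> T -> Prop) :
  (forall i, {ae mu, forall x, P i x}) -> {ae mu, forall x, forall i, P i x}.
Proof.
move=> aeP; have F := ae_filter_ringOfSetsType mu.
suff aeS (s : seq I) : {ae mu, forall x, forall i, i \in s -> P i x}.
  by apply: ae_imply (aeS (index_enum I)) _ => x Px i; apply: Px; rewrite mem_index_enum.
elim: s => [|i s IH]; first by apply: nearW.
apply: ae_imply2 (aeP i) IH _ => x Pix Px j.
by rewrite inE => /predU1P[->|/Px].
Qed.

Lemma is_solution_ae (R : realType) (n : nat) (t0 : R)
    (a g : 'I_n -> 'I_n -> R -> R) (phi : 'I_n -> R -> R) :
  (forall j k, {ae @completed_lebesgue_measure R, forall t, t0 <= t -> a j k t = g j k t}) ->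
  is_solution t0 a phi -> is_solution t0 g phi.
Proof.
move=> ag sol j; have [ac dphi] := sol j; split=> //.
apply: ae_imply2 (ae_forall_fin (ag j)) dphi _ => t agt dt t0t.
by have := dt t0t; under eq_bigr do rewrite agt//.
Qed.

(** * Linear systems with nonnegative off-diagonal coefficients *)

Section borel_system.
Context {R : realType} {n : nat}.
Variables (t0 : R) (g : 'I_n -> 'I_n -> R -> R).
Hypothesis ig : forall j k, borel_integrable_from t0 (g j k).
Hypothesis g_ge0 : forall j k t, j != k -> 0 <= g j k t.

Let A k := primitive t0 (g k k).

Let acA k : locally_absolutely_continuous_on `[t0, +oo[ (A k).
Proof. exact: primitive_locally_absolutely_continuous. Qed.

(** * Positivity and the exponential lower bound *)

Section positive_solution.
Variable phi : 'I_n -> R -> R.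
Hypothesis sol : is_solution t0 g phi.
Hypothesis phi_gt0 : forall k, 0 < phi k t0.

Let lower_bound_until s k : t0 <= s ->
  (forall j t, t0 <= t -> t < s -> 0 < phi j t) ->
  phi k t0 * expR (A k s) <= phi k s.
Proof.
move=> t0s pos; rewrite -ler_pdivlMr ?expR_gt0// -expRN.
have sub := @segment_sub_ray R t0 s.
pose F t := phi k t * expR (- A k t).
have acN : absolutely_continuous_on `[t0, s] (fun t => - A k t).
  apply: (absolutely_continuous_on_lip2 (C := 1) (acA k sub) (acA k sub)) => x y _ _.
  by rewrite mul1r -opprD normrN lerDl.
suff : F t0 <= F s by rewrite {1}/F /A primitive_init// oppr0 expR0 mulr1.
apply: absolutely_continuous_on_nondecreasing t0s _ _.
  apply: absolutely_continuous_onM; first by apply: (sol k).1.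
  exact: absolutely_continuous_on_expR.
(* Positivity is assumed only strictly before [s], so the endpoint [s] is added to the exceptional
   null set. *)
have ae_phi := ae_imply2 (ae_lebesgue_completed (sol k).2) (ae_neq s) (fun t => @conj _ _).
apply: ae_imply2 ae_phi (is_derive_primitive (ig k k)) _.
move=> t [dphi ts] dA t0t t_s.
have {}ts : t < s by rewrite lt_neqAle ts.
(* The diagonal term [g k k t * phi k t] cancels against the derivative of the exponential
   factor. *)
exists (expR (- A k t) * \sum_(j < n | j != k) g k j t * phi j t).
  rewrite mulr_ge0 ?expR_ge0//; apply: sumr_ge0 => j jk.
  by rewrite mulr_ge0 ?g_ge0 1?eq_sym// ltW// pos.
have ? := dphi t0t; have ? := dA t0t.
have dE : is_derive t 1 (fun t => expR (- A k t)) (expR (- A k t) * - g k k t).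
  exact: (@is_derive1_comp R expR (fun t => - A k t)).
apply: is_derive_eq; rewrite (bigD1 k)//=.
set S := \sum_(_ < _ | _) _; rewrite -[_ *: _]/(phi k t * _) -[X in _ + X]/(expR _ * _).
by ring.
Qed.

(** Real induction for all components at once: positivity before [s] gives the exponential bound,
    hence strict positivity, at [s]; continuity then carries each component a little further. *)
Lemma positive_solution_gt0 t k : t0 <= t -> 0 < phi k t.
Proof.
move=> t0t; move: t t0t k.
apply: real_induction => [s t0s pos k|s t0s pos].
  apply: lt_le_trans (lower_bound_until k t0s _); last by move=> j t ? ?; exact: pos.
  by rewrite mulr_gt0 ?expR_gt0.
have /choice[d dP] k : exists d, 0 < d /\
    forall t, s <= t -> t < s + d -> 0 < phi k t.
  have ac : absolutely_continuous_on `[s, s + 1] (phi k).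
    apply: (sol k).1 => x /=; rewrite !in_itv/= andbT => /andP[sx _].
    exact: le_trans sx.
  have [d d0 hd] := absolutely_continuous_on_single ac (pos k).
  exists (Num.min d 1); rewrite lt_min d0 ltr01; split=> // t st.
  rewrite -ltrBlDl lt_min => /andP[td t1].
  have : `|phi k t - phi k s| < phi k s.
    apply: hd => // x /=; rewrite !in_itv/= => /andP[-> xt] /=.
    by apply: le_trans xt _; lra.
  by rewrite ltr_norml => /andP[+ _]; lra.
(* Finitely many components have a common positive radius; the default 1 keeps the minimum positive
   for an empty family. *)
exists (\big[Num.min/1]_k d k).
  by apply: lt_bigmin => // k _; case: (dP k).
move=> t st td k; have [_] := dP k; apply => //; apply: lt_le_trans td _.
by rewrite lerD2l; exact: bigmin_le_cond.
Qed.

Lemma positive_solution_lower_bound t k : t0 <= t ->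
  phi k t0 * expR (A k t) <= phi k t.
Proof.
move=> t0t; apply: lower_bound_until => // j s t0s _.
exact: positive_solution_gt0.
Qed.

End positive_solution.

(** The factors exp (A_k) absorb the diagonal coefficients, whose sign is arbitrary, and leave a
    Volterra equation with zero diagonal and nonnegative kernel. *)
Lemma unit_solution_exists : exists2 phi, is_solution t0 g phi & forall k, phi k t0 = 1.
Proof.
pose b (k j : 'I_n) t := if j == k then 0 else g k j t * expR (A j t - A k t).
have mA k : measurable_fun setT (A k) by exact: measurable_primitive.
have ib k j : borel_integrable_from t0 (b k j).
  rewrite /b; case: eqVneq => _.
    by apply: borel_integrable_from_le (ig k j) _ _ => // t; rewrite normr0.
  apply: borel_integrable_fromM => //.
    by apply: measurableT_comp => //; exact: measurable_funB.
  move=> y; have sub := @segment_sub_ray R t0 y.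
  have /absolutely_continuous_on_bounded[M _ hM] :
      absolutely_continuous_on `[t0, y] (fun t => expR (A j t - A k t)).
    apply: absolutely_continuous_on_expR.
    apply: (absolutely_continuous_on_lip2 (C := 1) (acA j sub) (acA k sub)) => x z _ _.
    have -> : A j z - A k z - (A j x - A k x) = (A j z - A j x) - (A k z - A k x) by ring.
    by rewrite mul1r ler_normB.
  by exists M => t t0t ty; apply: hM; rewrite /= in_itv/= t0t.
have b0 k j t : 0 <= b k j t.
  by rewrite /b; case: eqVneq => // jk; rewrite mulr_ge0 ?expR_ge0 ?g_ge0// eq_sym.
have [v vP] := nonnegative_volterra_solution ib b0.
exists (fun k t => v k t * expR (A k t)) => [k|k]; last first.
  by have [_ ->] := vP k; rewrite /A !primitive_init// expR0 addr0 mulr1.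
have [ibv vE] := vP k; split.
  move=> x y xyD; apply: absolutely_continuous_onM; last first.
    by apply: absolutely_continuous_on_expR; exact: acA.
  have acP := primitive_locally_absolutely_continuous ibv xyD.
  apply: (absolutely_continuous_on_lip2 (C := 1) acP acP) => s z _ _.
  by rewrite !vE opprD addrACA subrr add0r mul1r lerDl.
apply: ae_completed_lebesgue.
apply: ae_imply2 (is_derive_primitive ibv) (is_derive_primitive (ig k k)) _.
move=> t dP dA t0t; have ? := dP t0t; have ? := dA t0t.
have dv : is_derive t 1 (v k) (\sum_j b k j t * v j t).
  rewrite (_ : v k = cst 1 + primitive t0 (fun s => \sum_j b k j s * v j s)).
    by apply: is_derive_eq; rewrite add0r.
  by apply/funext.
have dE : is_derive t 1 (fun t => expR (A k t)) (expR (A k t) * g k k t).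
  exact: (@is_derive1_comp R expR (A k)).
(* In the product rule the derivative of exp (A_k) yields the diagonal term; off the diagonal,
   [b k j t] times exp (A_k) is [g k j t] times exp (A_j). *)
apply: is_derive_eq; rewrite [RHS](bigD1 k)//= [X in _ + _ *: X](bigD1 k)//= {1}/b eqxx mul0r add0r.
rewrite -[_ *: _]/(v k t * _) -[X in _ + X]/(expR _ * _) mulr_sumr; congr (_ + _).
  by ring.
apply: eq_bigr => j jk; rewrite /b (negbTE jk) expRD expRN.
by field; rewrite gt_eqF// expR_gt0.
Qed.

End borel_system.

(* 'I_n is 0-based: i1 and i2 are the first and the second index, and
   (2 <= k)%N means that k is one of the others. *)
Theorem theorem3p2 (R : realType) (n : nat) (n_ge3 : (3 <= n)%N) (t0 : R)
    (a : 'I_n -> 'I_n -> R -> R)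
    (a_int : forall j k, locally_integrable_on `[t0, +oo[ (a j k))
    (a_ratio : forall i1 i2 k : 'I_n,
      i1 = 0%N :> nat -> i2 = 1%N :> nat -> (2 <= k)%N ->
      exists2 mu, is_ratio t0 (a i1 k) (a i1 i2) mu &
        absolutely_continuous_on `[t0, +oo[ mu)
    (a_ge0 : forall j k, j != k -> forall t, t0 <= t -> 0 <= a j k t) :
  [/\ forall phi, is_solution t0 a phi -> (forall k, 0 < phi k t0) ->
        forall t, t0 <= t -> forall k,
          phi k t0 *
            expR (\int[completed_lebesgue_measure]_(tau in `[t0, t]) a k k tau)
          <= phi k t,
      nonoscillatory t0 a,
      lyapunov_stable t0 a -> forall k,
        (ereal_sup [set
          (\int[completed_lebesgue_measure]_(tau in `[t0, t]) a k k tau)%:E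
          | t in `[t0, +oo[] < +oo)%E
    & asymptotically_stable t0 a -> forall k,
        \int[completed_lebesgue_measure]_(tau in `[t0, t]) a k k tau
          @[t --> +oo] --> -oo].
Proof.
have /choice[g gP] (jk : 'I_n * 'I_n) := locally_integrable_on_borel (a_int jk.1 jk.2).
pose gg j k := g (j, k).
have ig j k : borel_integrable_from t0 (gg j k) by case: (gP (j, k)).
have gg_ge0 j k t : j != k -> 0 <= gg j k t.
  by move=> jk; case: (gP (j, k)) => _ + _ _; apply=> s; exact: a_ge0.
have aeg j k : {ae @completed_lebesgue_measure R, forall t, t0 <= t -> a j k t = gg j k t}.
  by case: (gP (j, k)).
have intE k t : \int[completed_lebesgue_measure]_(tau in `[t0, t]) a k k tau =
    primitive t0 (gg k k) t.
  by case: (gP (k, k)) => _ _ _ gE; rewrite /primitive gE.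
have bound phi : is_solution t0 a phi -> (forall k, 0 < phi k t0) ->
    forall t, t0 <= t -> forall k,
    phi k t0 * expR (primitive t0 (gg k k) t) <= phi k t.
  move=> sol phi0 t t0t k.
  exact: (positive_solution_lower_bound ig gg_ge0 (is_solution_ae aeg sol)).
have [phi sol1 phi1] : exists2 phi, is_solution t0 a phi & forall k, phi k t0 = 1.
  have [phi sol1 phi1] := unit_solution_exists ig gg_ge0.
  exists phi => //; apply: is_solution_ae sol1 => j k.
  by apply: ae_imply (aeg j k) _ => t agt t0t; rewrite agt.
(* This single comparison with the unit solution drives all three consequences. *)
have le_phi t k : t0 <= t -> expR (primitive t0 (gg k k) t) <= phi k t.
  move=> t0t; have := bound _ sol1 (fun k => eq_ind_r (fun x => 0 < x) ltr01 (phi1 k)) t t0t k.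
  by rewrite phi1 mul1r.
split.
- by move=> psi sol psi0 t t0t k; rewrite intE; exact: bound.
- exists phi => //; exists t0 => // t t0t k.
  by rewrite gt_eqF// (lt_le_trans (expR_gt0 _) (le_phi t k t0t)).
- move=> stable k; have [M hM] := stable _ sol1 k.
  have le_M t : t0 <= t -> expR (primitive t0 (gg k k) t) <= M.
    by move=> t0t; apply: le_trans (le_phi t k t0t) (le_trans (ler_norm _) (hM t t0t)).
  (* The exponential of the integral is at most the unit solution, hence at most its bound [M]. *)
  apply: (@le_lt_trans _ _ (ln M)%:E); last exact: ltry.
  apply: ge_ereal_sup => _ [t /= + <-]; rewrite in_itv/= andbT => t0t.
  by rewrite lee_fin intE -ler_expR lnK ?le_M// posrE (lt_le_trans _ (le_M t t0t)) ?expR_gt0.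
- move=> stable k; under eq_fun do rewrite intE.
  apply/cvgrNyPle => N.
  (* Once the unit solution is below exp N, the integral is below [N]. *)
  have /cvgr0Pnorm_lt /(_ (expR N) (expR_gt0 N)) phiN := stable _ sol1 k.
  near=> t; rewrite -ler_expR.
  have t0t : t0 <= t by near: t; apply: nbhs_pinfty_ge; exact: num_real.
  apply: le_trans (le_phi t k t0t) (le_trans (ler_norm _) _).
  by apply: ltW; near: t.
Unshelve. all: by end_near.
Qed.
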